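(* Let $S$ be a left reversible bicancellative monoid, $S\curvearrowright X$ a surjective continuous action upon a topological space $X$, and $\boldsymbol{\Gamma}_S=(\Gamma_S,\gamma)$ the group of right fractions of $S$. Then: (i) if $S\curvearrowright X$ is topologically ergodic, then $\Gamma_S\curvearrowright X_{\boldsymbol{\Gamma}_S}$ is topologically ergodic; (ii) if $S\curvearrowright X$ is topologically transitive, then $\Gamma_S\curvearrowright X_{\boldsymbol{\Gamma}_S}$ is topologically transitive; (iii) if $S\curvearrowright X$ is minimal, then $\Gamma_S\curvearrowright X_{\boldsymbol{\Gamma}_S}$ is minimal.
   Context: All semigroups (in particular all monoids and groups) are countable and discrete. A continuous action of a monoid $S$ on a topological space $X$ is a map $(s,x)\mapsto s\cdot x$ with $1_S\cdot x=x$, $s\cdot(t\cdot x)=(st)\cdot x$, and each map $x\mapsto s\cdot x$ continuous; it is surjective if each of these maps is surjective. $S$ is bicancellative if $ab=ac$ or $ba=ca$ implies $b=c$, and left reversible if $sS\cap tS\neq\varnothing$ for all $s,t\in S$. The group of right fractions $\boldsymbol{\Gamma}_S=(\Gamma_S,\gamma)$ of a left reversible bicancellative $S$ is a group $\Gamma_S$ with an injective semigroup morphism $\gamma\colon S\to\Gamma_S$ such that every $g\in\Gamma_S$ equals $\gamma(s)\gamma(t)^{-1}$ for some $s,t\in S$; it exists and is unique up to isomorphism. $X_{\boldsymbol{\Gamma}_S}=\{(x_h)_{h\in\Gamma_S}\in X^{\Gamma_S}: s\cdot x_h=x_{\gamma(s)h}\text{ for all }s\in S,h\in\Gamma_S\}$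 with the subspace topology of the product topology and the shift action $(g\cdot\overline x)_h=x_{hg}$ of $\Gamma_S$. A continuous action $T\curvearrowright Y$ of a monoid is topologically ergodic if for every pair of non-empty open $U,V\subseteq Y$ there is $t\in T$ with $tU\cap V\neq\varnothing$; topologically transitive if there is $y\in Y$ whose orbit $Ty$ is dense in $Y$; minimal if every $y\in Y$ has dense orbit $Ty$. *)

(* Defs.v *)
From mathcomp Require Import all_boot.
From mathcomp Require Import boolp classical_sets functions cardinality topology.

Set Implicit Arguments.
Unset Strict Implicit.
Unset Printing Implicit Defensive.

Local Open Scope classical_set_scope.
Local Open Scope group_scope.

Definition bicancellative (S : monoidType) : Prop :=
  forall a b c : S, a * b = a * c \/ b * a = c * a -> b = c.

Definition left_reversible (S : monoidType) : Prop :=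
  forall s t : S,
    [set s * a | a in [set: S]] `&` [set t * a | a in [set: S]] !=set0.

Definition is_right_fractions_group (S : monoidType) (G : groupType)
    (gamma : {multiplicative S -> G}) : Prop :=
  injective gamma /\
  forall g : G, exists s t : S, g = gamma s * (gamma t)^-1.

Record continuous_action (S : monoidType) (X : topologicalType) :=
  ContinuousAction {
    act :> S -> X -> X;
    act1x : forall x, act 1 x = x;
    actMx : forall s t x, act s (act t x) = act (s * t) x;
    act_continuous : forall s, continuous (act s) }.

Definition surjective_action (S : monoidType) (X : topologicalType)
    (a : continuous_action S X) : Prop :=
  forall s : S, set_surj [set: X] [set: X] (a s).

Section Dynamics.
Variables (T : monoidType) (Y : topologicalType) (a : continuous_action T Y).

Definition action_orbit (y : Y) : set Y := [set a t y | t in [set: T]].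

Definition topologically_ergodic : Prop :=
  forall U V : set Y, open U -> open V -> U !=set0 -> V !=set0 ->
    exists t : T, a t @` U `&` V !=set0.

Definition topologically_transitive : Prop :=
  exists y : Y, dense (action_orbit y).

Definition minimal_action : Prop :=
  forall y : Y, dense (action_orbit y).

End Dynamics.

Section NaturalExtension.
Variables (S : monoidType) (X : topologicalType) (a : continuous_action S X).
Variables (G : groupType) (gamma : S -> G).

(* {ptws G -> X} carries the product topology, and this set, used as a type,
   carries the induced topology. *)
Definition natural_extension : set {ptws G -> X} :=
  [set x | forall (s : S) (h : G), a s (x h) = x (gamma s * h)].

Lemma natural_extension_shift (g : G) (x : natural_extension) :
  natural_extension (fun h => set_val x (h * g)).
Proof.
by move=> s h; case: x => x /= xE; have /= Ex := set_mem xE;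
  rewrite !set_valE /= Ex mulgA.
Qed.

Definition shift (g : G) (x : natural_extension) : natural_extension :=
  SigSub (mem_set (natural_extension_shift g x)).

Lemma shiftE (g : G) (x : natural_extension) (h : G) :
  set_val (shift g x) h = set_val x (h * g).
Proof. by rewrite !set_valE. Qed.

Lemma natural_extension_inj (x y : natural_extension) :
  (forall h, set_val x h = set_val y h) -> x = y.
Proof.
by move=> exy; apply: eq_sig_hprop => //; apply/funext => h; have := exy h;
  rewrite !set_valE.
Qed.

Lemma shift1x (x : natural_extension) : shift 1 x = x.
Proof. by apply: natural_extension_inj => h; rewrite shiftE mulg1. Qed.

Lemma shiftMx (g k : G) (x : natural_extension) :
  shift g (shift k x) = shift (g * k) x.
Proof. by apply: natural_extension_inj => h; rewrite !shiftE mulgA. Qed.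

Lemma eval_continuous (h : G) :
  continuous (fun x : natural_extension => set_val x h).
Proof.
have cval : continuous (set_val : natural_extension -> {ptws G -> X}).
  exact: initial_continuous.
move=> x; apply: (@continuous_comp natural_extension {ptws G -> X} X set_val
  (fun f => f h)); first exact: cval.
exact: (@proj_continuous G (fun=> X) h).
Qed.

Lemma shift_continuous (g : G) : continuous (shift g).
Proof.
apply: continuous_comp_initial => x.
apply/cvg_sup; first exact/fmap_filter/nbhs_filter.
move=> h.
have shcont : continuous ((fun y => set_val (shift g y)) :
    natural_extension -> initial_topology (fun f : G -> X => f h)).
  apply: continuous_comp_initial => y.
  rewrite (_ : _ \o _ = fun z : natural_extension => set_val z (h * g)).
    exact: eval_continuous.
  by apply/funext => z /=; rewrite shiftE.
exact: shcont.
Qed.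

Definition shift_action : continuous_action G natural_extension :=
  ContinuousAction shift1x shiftMx shift_continuous.

End NaturalExtension.

(* Main.v *)
(* A left reversible monoid S has common right multiples, so finitely many
   elements of G have the form gamma(s_i) k with a single k = gamma(u)^-1.
   Hence the sets {x | x_k \in W}, with W open and k of this form, are a basis of
   the topology of the natural extension.  All three properties then transfer
   through the single coordinate k, since x_(gamma(t) k) = t . x_k.  For
   ergodicity and transitivity one also needs points with a prescribed
   coordinate: enumerating S yields a sequence u_0 = 1, u_1, u_2, ..., each term
   a right multiple of the previous one, absorbing all of S, and lifting the
   prescribed point successively along the surjections of the action defines
   the coordinates at gamma(u_n)^-1, hence all of them. *)

Require Import Defs.
From mathcomp Require Import all_boot.
From mathcomp Require Import boolp classical_sets functions cardinality topology.

Local Open Scope classical_set_scope.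
Local Open Scope group_scope.

Lemma left_reversible_common_multiple {S : monoidType} (Slr : left_reversible S)
  (s t : S) : exists b c : S, s * b = t * c.
Proof. by have [_ [[b _ <-] [c _ e]]] := Slr s t; exists b, c. Qed.

Lemma countable_enumeration {S : monoidType} (Scount : countable [set: S]) :
  exists e : nat -> S, forall s, exists n, e n = s.
Proof.
have /pfcard_geP[S0|[e]] := Scount.
  by have : [set: S] 1 by []; rewrite S0.
by exists e => s; have [n _ en] := @surj _ _ _ _ e s I; exists n.
Qed.

Lemma cofinal_lift {S : monoidType} (Scount : countable [set: S])
    (Slr : left_reversible S) {X : topologicalType} {a : continuous_action S X}
    (a_surj : surjective_action a) (y : X) :
  exists (u : nat -> S) (z : nat -> X),
    [/\ u 0 = 1, z 0 = y, forall t, exists n b, u n = t * b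
      & forall m n, m <= n -> exists b, u n = u m * b /\ z m = a b (z n)].
Proof.
have [e e_surj] := countable_enumeration Scount.
(* One recursion step: [p] stands for (n, u_n, z_n) and [q] for (b, z), with u_n b a right multiple
   of [e n] and z a preimage of z_n under b. *)
have step (p : nat * S * X) : exists q : S * X,
    (exists c, p.1.2 * q.1 = e p.1.1 * c) /\ p.2 = a q.1 q.2.
  have [b [c bc]] := left_reversible_common_multiple Slr p.1.2 (e p.1.1).
  have [z _ az] := a_surj b p.2 I.
  by exists (b, z); split; [exists c|].
have [f fP] := choice step.
pose st := nat_rect (fun=> (S * X)%type) (1, y)
  (fun n p => (p.1 * (f (n, p.1, p.2)).1, (f (n, p.1, p.2)).2)).
exists (fun n => (st n).1), (fun n => (st n).2); split => // [t|m n].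
  have [n <-] := e_surj t; have [[c cE] _] := fP (n, (st n).1, (st n).2).
  by exists n.+1, c.
move=> /subnKC <-; elim: (n - m)%N => [|k [b [ub zb]]].
  by rewrite addn0; exists 1; rewrite mulg1 act1x.
have [_ /=] := fP (m + k, (st (m + k)).1, (st (m + k)).2).
rewrite addnS /=; set q := f _ => zE; exists (b * q.1).
by rewrite mulgA -ub -actMx -zE.
Qed.

Section NaturalExtensionTheory.
Context {S : monoidType} {X : topologicalType} {a : continuous_action S X}.
Context {G : groupType} {gamma : {multiplicative S -> G}}.
Implicit Types x : natural_extension a gamma.

Lemma natural_extensionE x (s : S) (h : G) :
  set_val x (gamma s * h) = a s (set_val x h).
Proof. by rewrite !set_valE; have /= -> := set_mem (valP x). Qed.

Lemma gmulf_magma1 : gamma 1 = 1.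
Proof. by apply: (mulgI (gamma 1)); rewrite -gmulfM !mulg1. Qed.

Lemma right_fraction_extend (s t b : S) :
  gamma s * (gamma t)^-1 = gamma (s * b) * (gamma (t * b))^-1.
Proof. by rewrite !gmulfM invgM mulgA mulgK. Qed.

(** Enlarging a denominator turns a condition on one coordinate into its preimage under [a c], so
    conditions at two denominators can be moved to a common one. *)
Lemma denominator_extend x (u c : S) :
  set_val x (gamma u)^-1 = a c (set_val x (gamma (u * c))^-1).
Proof. by rewrite -natural_extensionE gmulfM invgM mulVKg. Qed.

Lemma natural_extension_eval_surj (Scount : countable [set: S])
    (Slr : left_reversible S) (a_surj : surjective_action a)
    (Ggamma : is_right_fractions_group gamma) (h : G) (y : X) :
  exists x, set_val x h = y.
Proof.
suff [x x1] : exists x, set_val x 1 = y.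
  by exists (shift h^-1 x); rewrite shiftE mulgV.
have [gamma_inj fracG] := Ggamma.
have [u [z [u0 z0 u_cof uz]]] := cofinal_lift Scount Slr a_surj y.
(* [P] is the graph of the point to build: w is the value forced at h by the value z_n at
   gamma(u_n)^-1. *)
pose P h w := exists n s, h = gamma s * (gamma (u n))^-1 /\ w = a s (z n).
have exP g : exists w, P g w.
  have [s [t ->]] := fracG g; have [n [b ub]] := u_cof t.
  exists (a (s * b) (z n)), n, (s * b); split=> //.
  by rewrite ub -right_fraction_extend.
have P_le g w w' n s m t : n <= m -> g = gamma s * (gamma (u n))^-1 ->
    w = a s (z n) -> g = gamma t * (gamma (u m))^-1 -> w' = a t (z m) -> w = w'.
  move=> /uz[b [ub zb]] -> -> + ->.
  (* Over the common denominator u_m = u_n b, injectivity of [gamma] gives t = s b. *)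
  rewrite (right_fraction_extend s _ b) -ub => /mulIg /gamma_inj <-.
  by rewrite zb actMx.
have P_uniq g w w' : P g w -> P g w' -> w = w'.
  move=> [n [s [gs ws]]] [m [t [gt wt]]].
  have [nm|/ltnW mn] := leqP n m; first exact: P_le nm gs ws gt wt.
  by apply/esym; exact: P_le mn gt wt gs ws.
have [x xP] := choice exP.
have xS : natural_extension a gamma x.
  move=> s g; apply: P_uniq (xP _).
  have [n [t [-> ->]]] := xP g; exists n, (s * t).
  by rewrite gmulfM mulgA actMx.
exists (SigSub (mem_set xS)); rewrite set_valE /=.
apply: P_uniq (xP 1) _; exists 0%N, 1.
by rewrite u0 z0 gmulf_magma1 mulgV act1x.
Qed.

Lemma natural_extension_basis (Slr : left_reversible S)
    (Ggamma : is_right_fractions_group gamma)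
    (U : set (natural_extension a gamma)) x : open U -> U x ->
  exists (u : S) (W : set X), [/\ open W, W (set_val x (gamma u)^-1)
    & forall x', W (set_val x' (gamma u)^-1) -> U x'].
Proof.
have [_ fracG] := Ggamma.
pose B (p : S * set X) := [set x' : natural_extension a gamma |
  p.2 (set_val x' (gamma p.1)^-1)].
pose D := [set p : S * set X | open p.2 /\ p.2 (set_val x (gamma p.1)^-1)].
have open_act c W : open W -> open (a c @^-1` W).
  by apply: open_comp => ? _; exact: act_continuous.
have FF : Filter (filter_from D B).
  apply: filter_from_filter; first by exists (1, setT); split => //; exact: openT.
  move=> [u W] [v V] [/= oW Wx] [/= oV Vx].
  have [b [c bc]] := left_reversible_common_multiple Slr u v.
  exists (u * b, a b @^-1` W `&` a c @^-1` V).
    split; first by apply: openI; exact: open_act.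
    by split; rewrite /= -?denominator_extend // bc -denominator_extend.
  by move=> x' [/=]; rewrite -denominator_extend bc -denominator_extend.
(* Convergence says that every neighbourhood of x contains some [B p] with p in [D]; it is checked
   coordinatewise, writing h as a fraction. *)
have cvg_val : {ptws, set_val @ filter_from D B --> set_val x}.
  apply/cvg_sup => h A [_ [[W oW <-] Wx] WA]; apply: filterS WA _.
  have [s [t hE]] := fracG h; exists (t, a s @^-1` W).
    by split; [exact: open_act|rewrite /= -natural_extensionE -hE].
  by move=> x'; rewrite /B /= -natural_extensionE -hE.
move=> [A oA <-] Ax.
have [[u W] [oW Wx] WU] : filter_from D B (set_val @^-1` A).
  by apply: cvg_val; exact: open_nbhs_nbhs.
by exists u, W.
Qed.

End NaturalExtensionTheory.

Theorem proposition5p4 (S : monoidType) (Scount : countable [set: S])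
    (Sbc : bicancellative S) (Slr : left_reversible S)
    (X : topologicalType) (a : continuous_action S X)
    (a_surj : surjective_action a)
    (G : groupType) (gamma : {multiplicative S -> G})
    (Ggamma : is_right_fractions_group gamma) :
  [/\ topologically_ergodic a -> topologically_ergodic (shift_action a gamma),
      topologically_transitive a ->
        topologically_transitive (shift_action a gamma)
    & minimal_action a -> minimal_action (shift_action a gamma)].
Proof.
have eval_surj := natural_extension_eval_surj Scount Slr a_surj Ggamma.
have orbit_dense x : dense (action_orbit a (set_val x 1)) ->
    dense (action_orbit (shift_action a gamma) x).
  move=> x1_dense U [x0 Ux0] oU.
  have [u [W [oW Wx0 WU]]] := natural_extension_basis Slr Ggamma _ _ oU Ux0.
  have [w [Ww [t _ tx]]] := x1_dense W (ex_intro _ _ Wx0) oW.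
  (* The factor [gamma u] cancels the coordinate gamma(u)^-1, leaving x at gamma(t), which is t .
     x_1. *)
  exists (shift (gamma u * gamma t) x); split; last by exists (gamma u * gamma t).
  by apply: WU; rewrite shiftE mulKg -[gamma t]mulg1 natural_extensionE tx.
split=> [erg U V oU oV [x Ux] [y Vy]|[y y_dense]|min x]; last exact: orbit_dense.
  have [u [W [oW Wx WU]]] := natural_extension_basis Slr Ggamma _ _ oU Ux.
  have [v [W' [oW' Wy WV]]] := natural_extension_basis Slr Ggamma _ _ oV Vy.
  (* Both open conditions are moved to the single coordinate k = gamma(u b)^-1 = gamma(v c)^-1,
     where ergodicity on X applies. *)
  have [b [c bc]] := left_reversible_common_multiple Slr u v.
  have open_act d Z : open Z -> open (a d @^-1` Z).
    by apply: open_comp => ? _; exact: act_continuous.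
  have W0 : a b @^-1` W !=set0.
    by exists (set_val x (gamma (u * b))^-1); rewrite /= -denominator_extend.
  have W'0 : a c @^-1` W' !=set0.
    by exists (set_val y (gamma (v * c))^-1); rewrite /= -denominator_extend.
  have [t [q [[p /= Wp tp] W'q]]] :=
    erg _ _ (open_act b _ oW) (open_act c _ oW') W0 W'0.
  have [z zp] := eval_surj (gamma (u * b))^-1 p.
  (* This conjugate of gamma(t) satisfies k g = gamma(t) k, so the shifted point has t . p at k. *)
  pose g := gamma (u * b) * (gamma t * (gamma (u * b))^-1).
  exists g, (shift g z); split.
    by exists z => //; apply: WU; rewrite (denominator_extend _ _ b) zp.
  apply: WV; rewrite (denominator_extend _ _ c) -bc shiftE mulKg.
  by rewrite natural_extensionE zp tp.
have [x x1] := eval_surj 1 y.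
by exists x; apply: orbit_dense; rewrite x1.
Qed.
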